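(* Let $\alpha>n$, $p_\alpha=\frac{2n}{n-\alpha}$, and $p\in(p_\alpha,0)$. Let $B_1=\{x\in\mathbb{R}^n : |x|<1\}$. Then every positive solution $u\in L^p(\overline{B_1})$ to $$u(x)=\int_{B_1}\frac{u^{p-1}(y)}{|x-y|^{n-\alpha}}\,dy,\qquad x\in B_1,$$ is radially symmetric about the origin and strictly increasing in the radial direction.
   Context: Since $p<0$, for a positive function $u$ the condition $u\in L^p(\overline{B_1})$ means $\int_{B_1}u^p\,dx<\infty$. *)

(* Defs.v *)
From HB Require Import structures.
From mathcomp Require Import all_boot all_order all_algebra.
From mathcomp Require Import all_classical all_reals all_analysis.
From mathcomp Require Import measurable_realfun.

Set Implicit Arguments.
Unset Strict Implicit.
Unset Printing Implicit Defensive.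

Import Order.TTheory GRing.Theory Num.Theory.
Import numFieldNormedType.Exports.

Local Open Scope classical_set_scope.
Local Open Scope ring_scope.

(* R^n as n-tuples, with the product (Borel) sigma-algebra. *)
Notation Rn R n := (n.-tuple (measurableTypeR R)).

Section Euclidean.
Context {R : realType}.

(* `|x| would be the sup norm on row vectors, hence the explicit formula. *)
Definition eucl_dist n (x y : Rn R n) : R :=
  Num.sqrt (\sum_(i < n) (tnth x i - tnth y i) ^+ 2).

Definition eucl_norm n (x : Rn R n) : R :=
  Num.sqrt (\sum_(i < n) tnth x i ^+ 2).

Definition unit_ball n : set (Rn R n) := [set x | eucl_norm x < 1].

End Euclidean.

Section Lebesgue_Rn.
Context {R : realType}.
Local Open Scope ereal_scope.

Definition Rn_cons n (z : measurableTypeR R * Rn R n) : Rn R n.+1 :=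
  [tuple of z.1 :: z.2].

(* On the Borel sets of R^(n+1) = R * R^n, the product of the one-dimensional
   Lebesgue measure with that of R^n. *)
Fixpoint lebesgue_Rn n : set (Rn R n) -> \bar R :=
  if n is m.+1 then pushforward (lebesgue_measure \x @lebesgue_Rn m) (@Rn_cons m)
  else \d_[tuple].

Let measurable_Rn_cons n : measurable_fun setT (@Rn_cons n).
Proof. exact: measurable_cons. Qed.

Let preimage_Rn_cons n (A : set (Rn R n.+1)) :
  measurable A -> measurable (@Rn_cons n @^-1` A).
Proof.
by move=> mA; rewrite -[X in measurable X]setTI; exact: measurable_Rn_cons.
Qed.

Lemma lebesgue_Rn_subproof n : [/\ @lebesgue_Rn n set0 = 0,
  (forall A, 0 <= @lebesgue_Rn n A), semi_sigma_additive (@lebesgue_Rn n) &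
  sigma_finite setT (@lebesgue_Rn n)].
Proof.
elim: n => [|n [m0 m_ge0 m_add m_fin]].
  split; [exact: measure0 | by [] | exact: measure_semi_sigma_additive |].
  by apply: fin_num_fun_sigma_finite => [|A mA] /=; rewrite diracE ?ltry.
pose H1 := isMeasure.Build _ _ _ (@lebesgue_Rn n) m0 m_ge0 m_add.
pose mu1 : {measure set (Rn R n) -> \bar R} := HB.pack (@lebesgue_Rn n) H1.
pose H2 := Measure_isSigmaFinite.Build _ _ _ mu1 m_fin.
have [mu muE] : exists mu : {sigma_finite_measure set (Rn R n) -> \bar R},
    @lebesgue_Rn n = mu.
  by exists (HB.pack_for {sigma_finite_measure set (Rn R n) -> \bar R}
    (@lebesgue_Rn n) H1 H2).
split => /=; rewrite ?muE.
- by rewrite /pushforward preimage_set0 measure0.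
- by move=> A; rewrite /pushforward; apply: integral_ge0 => x _; rewrite /= -?muE; exact: m_ge0.
- exact: (@measure_semi_sigma_additive _ _ _
    (measure_function_pushforward__canonical__measure_function_Measure
       (lebesgue_measure \x mu) (@measurable_Rn_cons n))).
- have /sigma_finiteP[F [TF ndF Foo]] :=
    sigma_finiteT (lebesgue_measure : {sigma_finite_measure set _ -> \bar R}).
  have /sigma_finiteP[G [TG ndG Goo]] := sigma_finiteT mu.
  pose f (t : Rn R n.+1) : measurableTypeR R * Rn R n := (thead t, [tuple of behead t]).
  exists (fun k => f @^-1` (F k `*` G k)).
    apply/seteqP; split => // t _.
    have [i _ Fi] : (\bigcup_i F i) (thead t) by rewrite -TF.
    have [j _ Gj] : (\bigcup_i G i) [tuple of behead t] by rewrite -TG.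
    exists (maxn i j) => //; split => /=.
      by move: Fi; exact/subsetPset/ndF/leq_maxl.
    by move: Gj; exact/subsetPset/ndG/leq_maxr.
  move=> k; have [mFk Fk] := Foo k; have [mGk Gk] := Goo k; split.
    rewrite -[X in measurable X]setTI.
    apply: measurable_fun_pair; [|exact: measurable_behead| |exact: measurableX] => //.
    exact: measurable_tnth.
  rewrite /pushforward (_ : _ @^-1` _ = F k `*` G k).
    by rewrite product_measure1E// lte_mul_pinfty// ge0_fin_numE.
  apply/seteqP; split => -[x t]; rewrite /f /Rn_cons /= theadE.
    by move=> [? ?]; split => //=; rewrite (_ : t = [tuple of behead [tuple of x :: t]])//; apply/val_inj.
  by move=> [? ?]; split => //=; rewrite (_ : [tuple of behead [tuple of x :: t]] = t)//; apply/val_inj.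
Qed.

HB.instance Definition _ n := isMeasure.Build _ _ _ (@lebesgue_Rn n)
  (let: And4 h _ _ _ := lebesgue_Rn_subproof n in h)
  (let: And4 _ h _ _ := lebesgue_Rn_subproof n in h)
  (let: And4 _ _ h _ := lebesgue_Rn_subproof n in h).

HB.instance Definition _ n := Measure_isSigmaFinite.Build _ _ _ (@lebesgue_Rn n)
  (let: And4 _ _ _ h := lebesgue_Rn_subproof n in h).

Lemma lebesgue_Rn_box n (a b : 'I_n -> R) : (forall i, (a i <= b i)%R) ->
  lebesgue_Rn [set x : Rn R n | forall i, (a i <= tnth x i <= b i)%R] =
  (\prod_(i < n) (b i - a i)%R)%:E.
Proof.
elim: n a b => [|n IH] a b ab.
  by rewrite big_ord0 /= [LHS]diracE mem_set// => -[].
have mbox : measurable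
    [set x : Rn R n | forall i, (a (lift ord0 i) <= tnth x i <= b (lift ord0 i))%R].
  rewrite (_ : [set _ | _] = \bigcap_(i in [set: 'I_n])
      (@tnth _ _ ^~ i) @^-1` [set` `[a (lift ord0 i), b (lift ord0 i)]%R]); last first.
    apply/seteqP; split => [x abx i _ | x abx i]; last by have := abx i I; rewrite /= in_itv.
    by rewrite /= in_itv /=; exact: abx.
  apply: fin_bigcap_measurable => // i _.
  by rewrite -[X in measurable X]setTI; exact: measurable_tnth.
rewrite big_ord_recl EFinM -(IH (fun i => a (lift ord0 i)) (fun i => b (lift ord0 i)))//.
have -> : (b ord0 - a ord0)%:E = lebesgue_measure [set` `[a ord0, b ord0]%R].
  rewrite lebesgue_measure_itv /= lte_fin; case: ltgtP (ab ord0) => // ->.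
  by rewrite subrr.
rewrite -product_measure1E//= /pushforward; congr product_measure1.
apply/seteqP; split => -[x t]; rewrite /Rn_cons /=.
  move=> abt; split => [|i] /=; first by have := abt ord0; rewrite in_itv.
  by have := abt (lift ord0 i); rewrite tnthS.
rewrite in_itv /= => -[abx abt] i.
by case: (unliftP ord0 i) => [j|] -> //; rewrite tnthS.
Qed.

(* Measurability with respect to the Lebesgue sigma-algebra of R^n, i.e. the
   completion of the Borel one. Since the library integral of a nonnegative
   function is the supremum of the integrals of the simple functions below it,
   it is the Lebesgue integral of such functions too. *)
Definition lebesgue_measurable_fun n (D : set (Rn R n))
    (u : Rn R n -> measurableTypeR R) : Prop :=
  forall Y, measurable Y -> completed_algebra_gen (@lebesgue_Rn n) (D `&` u @^-1` Y).

End Lebesgue_Rn.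

Arguments unit_ball {R} n.
Arguments lebesgue_Rn {R} n.

(* Main.v *)
Require Import Defs.
From HB Require Import structures.
From mathcomp Require Import all_boot all_order all_algebra.
From mathcomp Require Import all_classical all_reals all_analysis.
From mathcomp Require Import measurable_realfun ring lra.

(** The theorem is proved by the method of moving planes in integral form. Put
    q = alpha - n > 0 and r = p - 1 < 0, let f be u^r on the unit ball and 0
    elsewhere, so that u is the potential of f for the kernel |x - y|^q.

    For a unit vector e with e_0 != 0 and 0 <= l < 1 write x' for the reflection
    of x in the hyperplane dot e x = l. Changing variables y |-> y' gives
      2 (u x - u x') = integral of (|x - y|^q - |x - y'|^q) (f y - f y') dy,
    whose integrand is symmetric under y |-> y'. The claim to propagate is
    u x' <= u x for all x in the cap of the ball where dot e x > l. Wherever it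
    holds at y, both factors of the integrand have the same sign, because the
    kernel is increasing in the distance, f is decreasing in u, and f vanishes
    outside of the ball. So only the set E of misordered points of the cap
    contributes negatively, and since u lies between two positive constants
    (solution_bounded, solution_bounded_below), the power u^r is Lipschitz in u
    and the largest gap G = sup (u x' - u x) over E satisfies
    G <= const * measure E * G (gap_contraction). Hence E is empty as soon as
    its measure is small (misordered_small). This holds for l close to 1, where
    the cap is small. When E is empty for some positive l < 1, the inequality
    is strict in the cap, because some points of the ball are reflected out of
    it (mirror_strict); then, for l slightly smaller, E has small measure by
    dominated convergence, hence is empty again. So E is empty for all l >= 0
    (misordered_empty).

    Letting l = 0 for e and for - e shows that u is invariant under these
    reflections in hyperplanes through the origin, whence radial symmetry
    (solution_radial), and the strict inequality for l = (s + t) / 2 along a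
    fixed axis gives monotonicity (solution_increasing).

    Three preliminaries carry the measure theory. The solution, given as
    measurable for the completed sigma-algebra, is Borel because it equals the
    potential of a Borel density (solution_Borel). Finiteness of the potential
    at two points makes f integrable (integrable_source), which yields the
    bounds on u and its continuity. Finally, Lebesgue measure of R^(m+1), built
    by iterated products, is invariant under reflections (preserves_mirror);
    this is obtained from invariance of the line under translations and
    x |-> - x by writing a reflection as a composition of shears. *)

Set Implicit Arguments.
Unset Strict Implicit.
Unset Printing Implicit Defensive.

Import Order.TTheory GRing.Theory Num.Theory.
Import numFieldNormedType.Exports.

Local Open Scope classical_set_scope.
Local Open Scope ring_scope.

(** * Measure-preserving maps *)

Definition preserves d (T : measurableType d) (R : realType)
    (mu : set T -> \bar R) (f : T -> T) :=
  measurable_fun setT f /\ forall A, measurable A -> mu (f @^-1` A) = mu A.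

Section measure_preserving.
Context d (T : measurableType d) (R : realType).
Variable mu : {measure set T -> \bar R}.

Lemma preserves_comp f g :
  preserves mu f -> preserves mu g -> preserves mu (f \o g).
Proof.
move=> [mf f1] [mg g1]; split; first exact: measurableT_comp.
move=> A mA; rewrite comp_preimage g1 ?f1//.
by rewrite -[X in measurable X]setTI; exact: mf.
Qed.

Lemma ge0_integral_preserves f (h : T -> \bar R) : preserves mu f ->
  measurable_fun setT h -> (forall x, 0 <= h x)%E ->
  (\int[mu]_x h (f x) = \int[mu]_x h x)%E.
Proof.
move=> [mf fmu] mh h0; have := ge0_integral_pushforward mf mu measurableT.
rewrite preimage_setT => <-//.
by apply: eq_measure_integral => A mA _; exact: fmu.
Qed.

Lemma integrable_preserves f (h : T -> \bar R) : preserves mu f ->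
  mu.-integrable setT h -> mu.-integrable setT (h \o f).
Proof.
move=> fmu /integrableP[mh hoo]; apply/integrableP; split.
  by apply: measurableT_comp => //; case: fmu.
have := @ge0_integral_preserves f (fun x => `|h x|%E) fmu.
by rewrite /= => ->//; exact: measurableT_comp.
Qed.

Lemma integral_preserves f (h : T -> \bar R) : preserves mu f ->
  mu.-integrable setT h -> (\int[mu]_x h (f x) = \int[mu]_x h x)%E.
Proof.
move=> [mf fmu] ih.
transitivity (\int[pushforward mu f]_x h x)%E.
  rewrite (integral_pushforward mf) ?preimage_setT//.
  - exact: measurable_int ih.
  - exact: integrable_preserves.
by apply: eq_measure_integral => A mA _; exact: fmu.
Qed.

End measure_preserving.

Section skew.
Context d1 d2 (T1 : measurableType d1) (T2 : measurableType d2) (R : realType).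
Variable m1 : {sigma_finite_measure set T1 -> \bar R}.
Variable m2 : {sigma_finite_measure set T2 -> \bar R}.

Lemma product_measure12 B : measurable B ->
  (m1 \x m2)%E B = (m1 \x^ m2)%E B.
Proof.
by move=> mB; apply: product_measure_unique => // *; exact: product_measure2E.
Qed.

(** Fubini: integrating the sections of a set over the first variable, the
    maps sigma s leave the measure of each section alone and tau only permutes
    the sections. The typical case is a
    shear in the second factor. *)
Lemma preserves_skewr (tau : T1 -> T1) (sigma : T1 -> T2 -> T2) :
  preserves m1 tau -> (forall s, preserves m2 (sigma s)) ->
  measurable_fun setT (fun z => (tau z.1, sigma z.1 z.2)) ->
  preserves (m1 \x m2)%E (fun z => (tau z.1, sigma z.1 z.2)).
Proof.
move=> tau1 sigma2 mG; split => // A mA.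
transitivity (\int[m1]_s m2 (xsection A (tau s)))%E.
  rewrite /product_measure1; apply: eq_integral => s _ /=.
  rewrite -((sigma2 s).2 (xsection A (tau s))); last exact: measurable_xsection.
  by congr (m2 _).
exact: (@ge0_integral_preserves _ _ _ m1 tau (m2 \o xsection A) tau1
  (measurable_fun_xsection _ mA) _).
Qed.

Lemma preserves_skewl (sigma : T2 -> T1 -> T1) :
  (forall t, preserves m1 (sigma t)) ->
  measurable_fun setT (fun z => (sigma z.2 z.1, z.2)) ->
  preserves (m1 \x m2)%E (fun z => (sigma z.2 z.1, z.2)).
Proof.
move=> sigma1 mG; split => // A mA.
rewrite !product_measure12//; last by rewrite -[X in measurable X]setTI; exact: mG.
rewrite /product_measure2; apply: eq_integral => t _ /=.
rewrite -((sigma1 t).2 (ysection A t)); last exact: measurable_ysection.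
by congr (m1 _).
Qed.

End skew.

Section line.
Context (R : realType).

Lemma preserves_opp : preserves (@lebesgue_measure R) -%R.
Proof. by split => // A mA; exact: lebesgue_measureN. Qed.

Lemma preserves_add (c : R) : preserves (@lebesgue_measure R) (fun x => x + c).
Proof.
have mc : measurable_fun setT ((fun x => x + c) : _ -> measurableTypeR R).
  by apply: measurable_funD => //; exact: measurable_cst.
split => // A mA.
apply/esym; apply: (@lebesgue_measure_unique R
  (measure_function_pushforward__canonical__measure_function_Measure
     (@lebesgue_measure R) mc)) => // _ [[a b]] _ <-.
rewrite /= /pushforward.
rewrite (_ : _ @^-1` _ = `]a - c, b - c]%classic); last first.
  by apply/seteqP; split => x /=; rewrite !in_itv/= ltrBlDr lerBrDr.
rewrite !lebesgue_measure_itv/= !lte_fin ltrD2r.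
by case: ifP => // _; rewrite -!EFinD; congr EFin; lra.
Qed.

End line.

(** * Reflections of Euclidean space preserve Lebesgue measure *)

Section reflection_def.
Context {R : realType}.

Definition dot n (x y : Rn R n) : R := \sum_(i < n) tnth x i * tnth y i.

Definition translate n (v x : Rn R n) : Rn R n :=
  [tuple tnth x i + tnth v i | i < n].

(** For a unit vector e this is the reflection in the hyperplane
    dot e x = l. *)
Definition mirror n (e : Rn R n) (l : R) (x : Rn R n) : Rn R n :=
  [tuple tnth x i - 2 * (dot e x - l) * tnth e i | i < n].

Definition Rn_uncons n (x : Rn R n.+1) : measurableTypeR R * Rn R n :=
  (thead x, [tuple of behead x]).

End reflection_def.

Section coordinates.
Context {R : realType}.

Lemma measurable_coord n i : measurable_fun setT (fun x : Rn R n => tnth x i).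
Proof. exact: measurable_tnth. Qed.

Lemma measurable_dot n (e : Rn R n) : measurable_fun setT (dot e).
Proof.
rewrite /dot; apply: measurable_sum => i; apply: measurable_funM => //.
exact: measurable_coord.
Qed.

Lemma measurable_translate n (v : Rn R n) : measurable_fun setT (translate v).
Proof.
apply/measurable_fun_tnthP => i.
rewrite [X in measurable_fun _ X](_ : _ = fun x => tnth x i + tnth v i).
  by apply: measurable_funD => //; exact: measurable_coord.
by apply/funext => x /=; rewrite tnth_mktuple.
Qed.

Lemma measurable_mirror n (e : Rn R n) l : measurable_fun setT (mirror e l).
Proof.
apply/measurable_fun_tnthP => i.
rewrite [X in measurable_fun _ X](_ : _ =
    fun x => tnth x i - 2 * (dot e x - l) * tnth e i).
  apply: measurable_funB; first exact: measurable_coord.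
  apply: measurable_funM => //; apply: measurable_funM => //.
  by apply: measurable_funB => //; exact: measurable_dot.
by apply/funext => x /=; rewrite tnth_mktuple.
Qed.

Lemma measurable_uncons n :
  measurable_fun setT (@Rn_uncons R n).
Proof.
by apply: measurable_fun_pair; [exact: measurable_coord|exact: measurable_behead].
Qed.

Lemma measurable_Rn_cons n : measurable_fun setT (@Rn_cons R n).
Proof. exact: measurable_cons. Qed.

(** The measure of R^(n+1) is by construction the product of those of R and
    R^n, so invariance can be checked in the pair (first coordinate, rest). *)
Lemma preserves_Rn_cons n (F : Rn R n.+1 -> Rn R n.+1)
    (G : measurableTypeR R * Rn R n -> measurableTypeR R * Rn R n) :
  (forall z, F (Rn_cons z) = Rn_cons (G z)) ->
  preserves (@lebesgue_measure R \x @lebesgue_Rn R n)%E G ->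
  preserves (@lebesgue_Rn R n.+1) F.
Proof.
move=> FG [mG pG]; split.
  rewrite (_ : F = @Rn_cons R n \o G \o @Rn_uncons R n).
    apply: (@measurableT_comp _ _ _ _ _ _ (@Rn_cons R n \o G) setT (@Rn_uncons R n)).
      apply: (@measurableT_comp _ _ _ _ _ _ (@Rn_cons R n) setT G) => //.
      exact: measurable_Rn_cons.
    exact: measurable_uncons.
  apply/funext => x /=; rewrite -FG; congr F.
  by rewrite [LHS]tuple_eta.
move=> A mA; rewrite /= /pushforward -comp_preimage.
rewrite -[RHS]pG; last by rewrite -[X in measurable X]setTI; exact: measurable_Rn_cons.
by congr product_measure1; apply/seteqP; split => z /=; rewrite FG.
Qed.

Lemma preserves_translate n (v : Rn R n) :
  preserves (@lebesgue_Rn R n) (translate v).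
Proof.
elim: n v => [|n IH] v.
  split; first exact: measurable_translate.
  move=> A mA; congr lebesgue_Rn.
  by apply/seteqP; split => x /=; rewrite [x]tuple0 [translate _ _]tuple0.
apply: (@preserves_Rn_cons n _
  (fun z => (z.1 + thead v, translate [tuple of behead v] z.2))).
  move=> [a x]; apply: eq_from_tnth => i; rewrite tnth_mktuple.
  case: (unliftP ord0 i) => [j|] ->; last by rewrite /Rn_cons !tnth0.
  rewrite !tnthS tnth_mktuple [in LHS](tuple_eta v) tnthS.
  by congr (_ + _).
apply: (@preserves_skewr _ _ _ _ R (@lebesgue_measure R) (@lebesgue_Rn R n)
  (fun a => a + thead v) (fun=> translate [tuple of behead v])).
- exact: preserves_add.
- by move=> _; exact: IH.
- apply: measurable_fun_pair.
    by apply: measurable_funD => //; exact: measurable_fst.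
  by apply: (measurableT_comp (measurable_translate _)); exact: measurable_snd.
Qed.


Lemma dotS n (x y : Rn R n.+1) : dot x y =
  tnth x ord0 * tnth y ord0 + dot [tuple of behead x] [tuple of behead y].
Proof.
rewrite /dot big_ord_recl; congr (_ + _); apply: eq_bigr => i _.
by rewrite [in LHS](tuple_eta x) [in LHS](tuple_eta y) !tnthS.
Qed.

Lemma dot_Rn_cons n (e : Rn R n.+1) (z : measurableTypeR R * Rn R n) :
  dot e (Rn_cons z) = tnth e ord0 * z.1 + dot [tuple of behead e] z.2.
Proof.
rewrite /dot big_ord_recl tnth0; congr (_ + _).
by apply: eq_bigr => i _; rewrite tnthS [in LHS](tuple_eta e) tnthS.
Qed.

(** In the coordinates (s, x') with s = (dot e x - l) / e_0, which differ
    from (x_0, x') by a shear along the first axis, the reflection is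
    (s, x') |-> (- s, x' - 2 s e_0 e'). It is therefore a composition of maps
    that act on one factor of R * R^n by translations, or by x |-> - x, with
    parameters depending on the other factor. The condition e_0 != 0 makes s a
    coordinate; the reflections that satisfy it already move every point of a
    sphere to the point where the sphere meets the first half-axis. *)
Lemma preserves_mirror n (e : Rn R n.+1) (l : R) :
  dot e e = 1 -> tnth e ord0 != 0 ->
  preserves (@lebesgue_Rn R n.+1) (mirror e l).
Proof.
move=> e1 e0.
pose e' : Rn R n := [tuple of behead e].
pose b (x : Rn R n) := (dot e' x - l) / tnth e ord0.
have mb : measurable_fun setT b.
  apply: measurable_funM => //; apply: measurable_funB => //.
  exact: measurable_dot.
(* The translation of the last coordinates caused by moving from s to - s. *)
pose w (s : R) : Rn R n := [tuple - 2 * s * tnth e ord0 * tnth e' i | i < n].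
have e'E : dot e' e' = 1 - tnth e ord0 ^+ 2.
  by rewrite -e1 dotS -/e'; ring.
have dotw s x : dot e' (translate (w s) x) =
    dot e' x - 2 * s * tnth e ord0 * (1 - tnth e ord0 ^+ 2).
  rewrite -e'E /dot mulr_sumr -sumrB; apply: eq_bigr => i _.
  by rewrite !tnth_mktuple; ring.
apply: (@preserves_Rn_cons n _ ((fun z => (z.1 - b z.2, z.2)) \o
  (fun z => (- z.1, translate (w z.1) z.2)) \o (fun z => (z.1 + b z.2, z.2)))).
  move=> [a x]; apply: eq_from_tnth => i; rewrite tnth_mktuple dot_Rn_cons /= -/e'.
  case: (unliftP ord0 i) => [j|] ->; last first.
    by rewrite /Rn_cons !tnth0 /b dotw /=; field.
  rewrite !tnthS !tnth_mktuple [in LHS](tuple_eta e) tnthS -/e'.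
  by rewrite /b; field.
apply: preserves_comp; first apply: preserves_comp.
- apply: (@preserves_skewl _ _ _ _ R (@lebesgue_measure R) (@lebesgue_Rn R n)
    (fun t a => a - b t)).
    by move=> t; exact: preserves_add.
  apply: measurable_fun_pair => //.
  apply: measurable_funB => //.
  exact: measurableT_comp mb _.
- apply: (@preserves_skewr _ _ _ _ R (@lebesgue_measure R) (@lebesgue_Rn R n)
    -%R (fun s => translate (w s))).
  + exact: preserves_opp.
  + by move=> s; exact: preserves_translate.
  + apply: measurable_fun_pair; first exact: measurableT_comp.
    apply/measurable_fun_tnthP => i.
    rewrite [X in measurable_fun _ X](_ : _ = fun z : measurableTypeR R * Rn R n =>
        tnth z.2 i + - 2 * z.1 * tnth e ord0 * tnth e' i).
      apply: measurable_funD.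
        exact: measurableT_comp (@measurable_coord n i) _.
      by do 2 (apply: measurable_funM => //); exact: measurable_funM.
    by apply/funext => z /=; rewrite !tnth_mktuple.
- apply: (@preserves_skewl _ _ _ _ R (@lebesgue_measure R) (@lebesgue_Rn R n)
    (fun t a => a + b t)).
    by move=> t; exact: preserves_add.
  apply: measurable_fun_pair => //.
  apply: measurable_funD => //.
  exact: measurableT_comp mb _.
Qed.

Lemma measurable_hyperplane n (e : Rn R n) (c : R) :
  measurable [set x | dot e x = c].
Proof.
rewrite (_ : [set _ | _] = setT `&` dot e @^-1` [set c]); last by rewrite setTI.
by apply: measurable_dot => //; exact: measurable_set1.
Qed.

(** Each line parallel to the first axis meets the hyperplane in one point. *)
Lemma lebesgue_Rn_hyperplane n (e : Rn R n.+1) (c : R) : tnth e ord0 != 0 ->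
  @lebesgue_Rn R n.+1 [set x | dot e x = c] = 0%E.
Proof.
move=> e0; rewrite /= /pushforward.
rewrite (@product_measure12 _ _ _ _ R (@lebesgue_measure R) (@lebesgue_Rn R n)).
  rewrite /product_measure2 integral0_eq// => t _ /=.
  rewrite (_ : ysection _ _ =
      [set (c - dot [tuple of behead e] t) / tnth e ord0]).
    exact: lebesgue_measure_set1.
  apply/seteqP; split => a /=; rewrite /ysection /= inE /= dot_Rn_cons /=.
    by move=> <-; field.
  by move=> ->; field.
rewrite -[X in measurable X]setTI; apply: measurable_Rn_cons => //.
exact: measurable_hyperplane.
Qed.

End coordinates.

(** * Distances, the unit ball and reflections *)

Section geometry.
Context {R : realType}.
Variable n : nat.
Implicit Types x y e : Rn R n.

Lemma sqr_eucl_norm x : eucl_norm x ^+ 2 = dot x x.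
Proof.
rewrite sqr_sqrtr; first by apply: eq_bigr => i _; rewrite expr2.
by apply: sumr_ge0 => i _; exact: sqr_ge0.
Qed.

Lemma sqr_eucl_dist x y :
  eucl_dist x y ^+ 2 = \sum_(i < n) (tnth x i - tnth y i) ^+ 2.
Proof. by rewrite sqr_sqrtr//; apply: sumr_ge0 => i _; exact: sqr_ge0. Qed.

Lemma eucl_norm_ge0 x : 0 <= eucl_norm x. Proof. exact: sqrtr_ge0. Qed.

Lemma eucl_dist_ge0 x y : 0 <= eucl_dist x y. Proof. exact: sqrtr_ge0. Qed.

Lemma eucl_distC x y : eucl_dist x y = eucl_dist y x.
Proof. by congr Num.sqrt; apply: eq_bigr => i _; ring. Qed.

Lemma sqr_eucl_dist_dot x y :
  eucl_dist x y ^+ 2 = dot x x - 2 * dot x y + dot y y.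
Proof.
rewrite sqr_eucl_dist /dot mulr_sumr -sumrB -big_split/=.
by apply: eq_bigr => i _; ring.
Qed.

Lemma unit_ballE x : unit_ball n x <-> dot x x < 1.
Proof.
by rewrite /unit_ball/= -sqr_eucl_norm expr_lt1// eucl_norm_ge0.
Qed.

Lemma eucl_dist_ball_le2 x y :
  unit_ball n x -> unit_ball n y -> eucl_dist x y <= 2.
Proof.
move=> /unit_ballE x1 /unit_ballE y1.
rewrite -(@ler_pXn2r _ 2)// ?nnegrE ?eucl_dist_ge0//.
have : 0 <= \sum_(i < n) (tnth x i + tnth y i) ^+ 2.
  by apply: sumr_ge0 => i _; exact: sqr_ge0.
have -> : \sum_(i < n) (tnth x i + tnth y i) ^+ 2 =
    dot x x + 2 * dot x y + dot y y.
  by rewrite /dot mulr_sumr -!big_split/=; apply: eq_bigr => i _; ring.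
by rewrite sqr_eucl_dist_dot; lra.
Qed.

Lemma coord_dist_le x y i : `|tnth x i - tnth y i| <= eucl_dist x y.
Proof.
rewrite -(@ler_pXn2r _ 2)// ?nnegrE ?eucl_dist_ge0// sqr_eucl_dist.
rewrite -normrX ger0_norm ?sqr_ge0// (bigD1 i)//= lerDl.
by apply: sumr_ge0 => j _; exact: sqr_ge0.
Qed.

Lemma measurable_eucl_dist :
  measurable_fun setT (fun z : Rn R n * Rn R n => eucl_dist z.1 z.2).
Proof.
apply: (@measurableT_comp _ _ _ _ _ _ (@Num.sqrt R)) => /=.
  by apply: continuous_measurable_fun; exact: sqrt_continuous.
apply: measurable_sum => i; apply: measurable_funX; apply: measurable_funB.
  exact: measurableT_comp (@measurable_coord R n i) _.
exact: measurableT_comp (@measurable_coord R n i) _.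
Qed.

Lemma measurable_unit_ball : measurable (@unit_ball R n).
Proof.
have mN : measurable_fun setT (fun x : Rn R n => eucl_norm x).
  apply: (@measurableT_comp _ _ _ _ _ _ (@Num.sqrt R)) => /=.
    by apply: continuous_measurable_fun; exact: sqrt_continuous.
  apply: measurable_sum => i; apply: measurable_funX.
  exact: measurable_coord.
rewrite (_ : unit_ball n = setT `&` (fun x => eucl_norm x) @^-1` `]-oo, 1[%classic).
  by apply: mN => //; exact: measurable_itv.
by apply/seteqP; split => x /=; rewrite in_itv/=; tauto.
Qed.

End geometry.

Section reflection_geometry.
Context {R : realType}.
Variable n : nat.
Variable e : Rn R n.
Hypothesis e1 : dot e e = 1.
Implicit Types (x y : Rn R n) (l : R).

Lemma dot_mirror l x : dot e (mirror e l x) = 2 * l - dot e x.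
Proof.
rewrite {1}/dot; under eq_bigr do rewrite tnth_mktuple.
have -> : \sum_(i < n) tnth e i * (tnth x i - 2 * (dot e x - l) * tnth e i) =
   dot e x - 2 * (dot e x - l) * dot e e.
  by rewrite /dot mulr_sumr -sumrB; apply: eq_bigr => i _; ring.
by rewrite e1; ring.
Qed.

Lemma mirrorK l : involutive (mirror e l).
Proof.
move=> x; apply: eq_from_tnth => i.
by rewrite !tnth_mktuple dot_mirror; ring.
Qed.

(** The sign of the last term says on which side of the hyperplane x and y
    lie, which is what compares the kernel at x and at its mirror image. *)
Lemma sqr_dist_mirrorl l x y : eucl_dist (mirror e l x) y ^+ 2 =
  eucl_dist x y ^+ 2 + 4 * (dot e x - l) * (dot e y - l).
Proof.
rewrite !sqr_eucl_dist; under eq_bigr do rewrite tnth_mktuple.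
set s := dot e x - l.
have -> : \sum_(i < n) (tnth x i - 2 * s * tnth e i - tnth y i) ^+ 2 =
    \sum_(i < n) (tnth x i - tnth y i) ^+ 2 -
    4 * s * (dot e x - dot e y) + 4 * s ^+ 2 * dot e e.
  rewrite /dot -sumrB !mulr_sumr -sumrB -big_split/=.
  by apply: eq_bigr => i _; ring.
by rewrite e1 /s; ring.
Qed.

Lemma dist_mirrorC l x y :
  eucl_dist x (mirror e l y) = eucl_dist (mirror e l x) y.
Proof.
apply/eqP; rewrite -(@eqrXn2 _ 2)// ?eucl_dist_ge0//; apply/eqP.
by rewrite eucl_distC !sqr_dist_mirrorl eucl_distC; ring.
Qed.

Lemma dist_mirror l x y :
  eucl_dist (mirror e l x) (mirror e l y) = eucl_dist x y.
Proof. by rewrite dist_mirrorC mirrorK. Qed.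

Lemma sqr_norm_mirror l x :
  dot (mirror e l x) (mirror e l x) = dot x x - 4 * l * (dot e x - l).
Proof.
set s := dot e x - l.
have -> : dot (mirror e l x) (mirror e l x) =
    dot x x - 4 * s * dot e x + 4 * s ^+ 2 * dot e e.
  rewrite {1}/dot; under eq_bigr do rewrite !tnth_mktuple -/s.
  rewrite /dot !mulr_sumr -sumrB -big_split/=.
  by apply: eq_bigr => i _; ring.
by rewrite e1 /s; ring.
Qed.

Lemma dist_mirror_le l x y : l <= dot e x -> l <= dot e y ->
  eucl_dist x y <= eucl_dist x (mirror e l y).
Proof.
move=> lx ly; rewrite dist_mirrorC -(@ler_pXn2r _ 2)// ?nnegrE ?eucl_dist_ge0//.
by rewrite sqr_dist_mirrorl lerDl !mulr_ge0// subr_ge0.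
Qed.

Lemma dist_mirror_lt l x y : l < dot e x -> l < dot e y ->
  eucl_dist x y < eucl_dist x (mirror e l y).
Proof.
move=> lx ly; rewrite dist_mirrorC -(@ltr_pXn2r _ 2)// ?nnegrE ?eucl_dist_ge0//.
by rewrite sqr_dist_mirrorl ltrDl !mulr_gt0// subr_gt0.
Qed.

(** Reflecting a cap cut off by a hyperplane not beyond the origin moves it
    towards the origin. *)
Lemma unit_ball_mirror l x : 0 <= l -> l <= dot e x ->
  unit_ball n x -> unit_ball n (mirror e l x).
Proof.
move=> l0 lx /unit_ballE x1; apply/unit_ballE; rewrite sqr_norm_mirror.
apply: le_lt_trans x1; rewrite lerBlDr lerDl !mulr_ge0// subr_ge0//.
Qed.

Lemma dot_lt1 x : unit_ball n x -> dot e x < 1.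
Proof.
move=> /unit_ballE x1.
have := sqr_ge0 (eucl_dist e x); rewrite sqr_eucl_dist_dot e1; lra.
Qed.

End reflection_geometry.

(** * Potentials and Borel measurability of solutions *)

Section nonmeasurable_integral.
Context d (T : measurableType d) (R : realType).
Variable mu : {measure set T -> \bar R}.
Local Open Scope ereal_scope.
Import HBNNSimple.

(** The integral of a nonnegative function is a supremum over the simple
    functions below it, so monotonicity holds for arbitrary functions. *)
Lemma ge0_le_integral_any (f g : T -> \bar R) :
  (forall x, 0 <= f x) -> (forall x, f x <= g x) ->
  \int[mu]_x f x <= \int[mu]_x g x.
Proof.
move=> f0 fg; have g0 x : 0 <= g x by exact: le_trans (fg x).
rewrite !ge0_integralTE//; apply: le_ereal_sup => _ [h hf <-].
by exists h => // x; exact: le_trans (fg x).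
Qed.

(** Needed for integrands that are only measurable for the completed
    sigma-algebra: cutting a simple function below f off on N does not change
    its integral. *)
Lemma ge0_integral_null (D N : set T) (f : T -> \bar R) :
  measurable D -> measurable N -> (forall x, D x -> 0 <= f x) -> mu N = 0 ->
  \int[mu]_(x in D) f x = \int[mu]_(x in D `\` N) f x.
Proof.
move=> mD mN f0 muN; rewrite !(integral_mkcond (D `\` N)) (integral_mkcond D).
have f'0 E : E `<=` D -> forall x, 0 <= (f \_ E) x.
  by move=> ED x; rewrite patchE; case: ifPn => // /set_mem/ED; exact: f0.
apply/eqP; rewrite eq_le; apply/andP; split; last first.
  apply: ge0_le_integral_any; first by apply: f'0; exact: subDsetl.
  move=> x; rewrite !patchE in_setD.
  by case: ifPn => [/andP[-> _]//|_]; exact: f'0.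
rewrite [leLHS]ge0_integralTE; last exact: f'0.
apply: ge_ereal_sup => _ [h hf <-].
have -> : sintegral mu h = \int[mu]_x (h x)%:E.
  by rewrite integral_nnsfun// patch_setT.
rewrite (ge0_negligible_integral mN)//; last 2 first.
- by apply/measurable_EFinP.
- by move=> x _; rewrite lee_fin; exact: fun_ge0.
rewrite integral_mkcond; apply: ge0_le_integral_any => x.
  by rewrite patchE; case: ifPn => // _; rewrite lee_fin; exact: fun_ge0.
rewrite patchE setTD in_setC; case: ifPn => xN; last exact: (f'0 _ (@subDsetl _ _ _)).
apply: (le_trans (hf x)); rewrite !patchE in_setD xN andbT.
by case: ifPn.
Qed.

End nonmeasurable_integral.

Section completion.
Context {R : realType}.
Variable n : nat.

(** The sets where u exceeds a rational r are Borel up to a null set; discard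
    the union of these countably many null sets. *)
Lemma lebesgue_measurable_fun_Borel (D : set (Rn R n)) (u : Rn R n -> R) :
  measurable D -> lebesgue_measurable_fun D u ->
  exists M, [/\ measurable M, lebesgue_Rn n M = 0%E &
    measurable_fun (D `\` M) u].
Proof.
move=> mD um.
have /choice[M HM] : forall r : rat, exists M, [/\ measurable M,
    lebesgue_Rn n M = 0%E & measurable (D `&` [set x | ratr r < u x] `\` M)].
  move=> r; have [A mA [N [M [mM M0 NM] AN]]] :=
    um `]ratr r, +oo[%classic (@measurable_itv R _).
  exists M; split => //.
  rewrite -preimage_itvoy -AN setDUl (_ : N `\` M = set0); last first.
    by rewrite setD_eq0.
  by rewrite setU0; exact: measurableD.
exists (\bigcup_(r : rat) M r).
have mM : measurable (\bigcup_(r : rat) M r).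
  by apply: bigcupT_measurable_rat => r; have [] := HM r.
split => //.
  (* Enumerate the rationals, since null sets are closed under unions over nat. *)
  pose F k := if unpickle k is Some r then M r else set0.
  have -> : \bigcup_(r : rat) M r = \bigcup_k F k.
    apply/seteqP; split => x [].
      by move=> r _ Mx; exists (pickle r); [exact: I|rewrite /F pickleK; exact: Mx].
    by move=> k _; rewrite /F; case: unpickle => // r Mx; exists r.
  have F0 k : measurable (F k) /\ lebesgue_Rn n (F k) = 0%E.
    rewrite /F; case: unpickle => [r|]; first by have [] := HM r.
    by split => //; exact: measure0.
  apply/negligibleP; first by apply: bigcupT_measurable => k; case: (F0 k).
  apply: negligible_bigcup => k; have [mF F00] := F0 k.
  exact/negligibleP.
move=> mDM; apply: (measurability _ (RGenOInfty.measurableE R)) => //.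
move=> /= _ [_ [a ->] <-]; rewrite preimage_itvoy.
rewrite [X in measurable X](_ : _ = \bigcup_(r : rat)
  ((if a < ratr r then D `&` [set x | ratr r < u x] `\` M r else set0) `\`
    \bigcup_(r : rat) M r)).
  apply: bigcupT_measurable_rat => r; apply: measurableD => //.
  by case: ifPn => // _; have [] := HM r.
apply/seteqP; split => x /=.
  move=> [[Dx Mx] /rat_in_itvoo[r]]; rewrite inE => /itvP h.
  exists r => //; rewrite h; split => //; split; first by split => //=; rewrite h.
  by move=> Mrx; apply: Mx; exists r.
move=> [r _ [+ Mx]]; case: ifPn => // ar [[Dx rx] _]; split => //.
exact: lt_trans rx.
Qed.

End completion.

Section potential.
Context {R : realType}.
Variable n : nat.
Notation mu := (@lebesgue_Rn R n).
Notation B := (@unit_ball R n).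

Definition potential (q : R) (f : Rn R n -> R) (x : Rn R n) : \bar R :=
  (\int[mu]_y (eucl_dist x y `^ q * f y)%:E)%E.

Lemma measurable_potential_integrand q (f : Rn R n -> R) : measurable_fun setT f ->
  measurable_fun setT
    (fun z : Rn R n * Rn R n => (eucl_dist z.1 z.2 `^ q * f z.2)%:E).
Proof.
move=> mf; apply/measurable_EFinP; apply: measurable_funM.
  apply: (measurableT_comp (measurable_powR q)).
  exact: measurable_eucl_dist.
exact: measurableT_comp mf _.
Qed.

Lemma measurable_potential q (f : Rn R n -> R) : measurable_fun setT f ->
  (forall y, 0 <= f y) -> measurable_fun setT (potential q f).
Proof.
move=> mf f0.
have := @measurable_fun_fubini_tonelli_F _ _ _ _ _ mu _
  (measurable_potential_integrand q mf).
by apply => z; rewrite lee_fin mulr_ge0// powR_ge0.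
Qed.

(** The density u^r on D, extended by 0, so that potentials are integrals
    over the whole space, where reflections act. *)
Definition cutoff (D : set (Rn R n)) (u : Rn R n -> R) r :=
  (fun y => u y `^ r) \_ D.

Lemma cutoff_ge0 D u r y : 0 <= cutoff D u r y.
Proof. by rewrite /cutoff patchE; case: ifPn => // _; exact: powR_ge0. Qed.

Lemma cutoff_in D u r y : D y -> cutoff D u r y = u y `^ r.
Proof. by move=> Dy; rewrite /cutoff patchE mem_set. Qed.

Lemma cutoff_out D u r y : ~ D y -> cutoff D u r y = 0.
Proof. by move=> Dy; rewrite /cutoff patchE memNset. Qed.

Lemma measurable_cutoff D (u : Rn R n -> R) r : measurable D -> measurable_fun D u ->
  measurable_fun setT (cutoff D u r).
Proof.
move=> mD um; apply/(measurable_restrictT _ mD).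
exact: (measurableT_comp (measurable_powR r)) um.
Qed.

Lemma integral_cutoff q D u r x :
  (\int[mu]_(y in D) (eucl_dist x y `^ q * u y `^ r)%:E)%E =
  potential q (cutoff D u r) x.
Proof.
rewrite integral_mkcond; apply: eq_integral => y _.
by rewrite /cutoff !patchE; case: ifPn => // _; rewrite mulr0.
Qed.

(** The integral does not see a null set outside of which u is Borel, and the
    resulting potential is a Borel function of x by Tonelli's theorem; but it is
    u itself. *)
Lemma solution_Borel q r (u : Rn R n -> R) :
  lebesgue_measurable_fun B u ->
  (forall x, B x ->
    (u x)%:E = (\int[mu]_(y in B) (eucl_dist x y `^ q * u y `^ r)%:E)%E) ->
  measurable_fun B u.
Proof.
move=> um sol; have mB := @measurable_unit_ball R n.
have [M [mM M0 mDM]] := lebesgue_measurable_fun_Borel mB um.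
apply/measurable_EFinP.
apply: (@eq_measurable_fun _ _ _ _ _ (potential q (cutoff (B `\` M) u r))).
  move=> x /set_mem Bx; rewrite -integral_cutoff /= sol//.
  rewrite [RHS](ge0_integral_null mB mM)// => y _.
  by rewrite lee_fin mulr_ge0// powR_ge0.
apply: measurable_funTS; apply: measurable_potential; last exact: cutoff_ge0.
by apply: measurable_cutoff => //; exact: measurableD.
Qed.

End potential.

(** * Points on the first axis, boxes and real powers *)

Section axis.
Context {R : realType}.
Variable n : nat.

Definition axis (t : R) : Rn R n.+1 := [tuple (if i == ord0 then t else 0) | i < n.+1].

Lemma dot_axis t x : dot (axis t) x = t * tnth x ord0.
Proof.
rewrite /dot (bigD1 ord0)//= tnth_mktuple eqxx big1 ?addr0// => i /negPf i0.
by rewrite tnth_mktuple i0 mul0r.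
Qed.

Lemma tnth_axis0 t : tnth (axis t) ord0 = t.
Proof. by rewrite tnth_mktuple eqxx. Qed.

Lemma axis_unit_ball t : `|t| < 1 -> unit_ball n.+1 (axis t).
Proof.
move=> t1; apply/unit_ballE.
by rewrite dot_axis tnth_axis0 -expr2 -real_normK ?num_real// expr_lt1.
Qed.

End axis.

Section boxes.
Context {R : realType}.
Variable n : nat.

Definition box (a b : 'I_n -> R) : set (Rn R n) :=
  [set x | forall i, a i <= tnth x i <= b i].

Lemma measurable_box a b : measurable (box a b).
Proof.
rewrite (_ : box a b = \bigcap_(i in [set: 'I_n])
    (@tnth _ _ ^~ i) @^-1` [set` `[a i, b i]%R]); last first.
  apply/seteqP; split => [x abx i _ | x abx i].
    by rewrite /= in_itv /=; exact: abx.
  by have := abx i I; rewrite /= in_itv.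
apply: fin_bigcap_measurable => // i _.
by rewrite -[X in measurable X]setTI; exact: measurable_tnth.
Qed.

Lemma lebesgue_Rn_box_gt0 a b : (forall i, a i < b i) ->
  (0 < @lebesgue_Rn R n (box a b))%E.
Proof.
move=> ab; rewrite /box lebesgue_Rn_box; last by move=> i; exact/ltW.
by rewrite lte_fin; apply: prodr_gt0 => i _; rewrite subr_gt0.
Qed.

Lemma lebesgue_Rn_unit_ball_lty : (@lebesgue_Rn R n (@unit_ball R n) < +oo)%E.
Proof.
have sub : @unit_ball R n `<=` box (fun=> -1) (fun=> 1).
  move=> x /unit_ballE x1 i; rewrite -ler_norml.
  rewrite -(@ler_pXn2r _ 2)// ?nnegrE// expr1n real_normK ?num_real//.
  apply: le_trans (ltW x1); rewrite /dot (bigD1 i)//= -expr2 lerDl.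
  by apply: sumr_ge0 => j _; rewrite -expr2 sqr_ge0.
apply: le_lt_trans (le_measure _ _ _ sub) _; rewrite ?inE//.
- exact: measurable_unit_ball.
- exact: measurable_box.
rewrite [ltLHS](@lebesgue_Rn_box R n (fun=> -1) (fun=> 1)) ?ltry// => i; lra.
Qed.

End boxes.

Section powers.
Context {R : realType}.

Lemma powR_le_homo (q : R) : 0 <= q ->
  forall x y, 0 <= x -> x <= y -> x `^ q <= y `^ q.
Proof.
move=> q0 x y x0 xy; apply: ge0_ler_powR => //; rewrite nnegrE//.
exact: le_trans xy.
Qed.

Lemma powR_lt_homo (q : R) : 0 < q ->
  forall x y, 0 <= x -> x < y -> x `^ q < y `^ q.
Proof.
move=> q0 x y x0 xy; apply: gt0_ltr_powR => //; rewrite nnegrE//.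
exact: le_trans (ltW xy).
Qed.

Lemma powR_nhomo (r : R) : r <= 0 ->
  forall x y, 0 < x -> x <= y -> y `^ r <= x `^ r.
Proof.
move=> r0 x y x0 xy; rewrite -(opprK r) !(powRN _ (- r)).
rewrite lef_pV2 ?posrE ?powR_gt0//; last exact: lt_le_trans xy.
by apply: powR_le_homo; rewrite ?oppr_ge0 // ltW.
Qed.

(** With r <= 0, convexity of the power function: from 1 + t <= exp t one gets
    1 - (y/x)^r <= - r * ln (y/x) <= - r * (y/x - 1). *)
Lemma powR_lipschitz (r c : R) : r <= 0 -> 0 < c ->
  forall x y, c <= x -> x <= y -> x `^ r - y `^ r <= - r * c `^ (r - 1) * (y - x).
Proof.
move=> r0 c0 x y cx xy.
have x0 : 0 < x by exact: lt_le_trans cx.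
have y0 : 0 < y by exact: lt_le_trans xy.
have lnyx : ln y - ln x <= (y - x) / x.
  rewrite -ln_div ?posrE// -ler_expR lnK ?posrE ?divr_gt0//.
  apply: le_trans (expR_ge1Dx _); rewrite mulrBl divff ?gt_eqF//; lra.
have e1 : 1 - y `^ r / x `^ r <= - r * ((y - x) / x).
  rewrite /powR !gt_eqF// -expRB.
  have := expR_ge1Dx (r * ln y - r * ln x).
  have : - r * (ln y - ln x) <= - r * ((y - x) / x).
    by apply: ler_wpM2l => //; rewrite oppr_ge0.
  lra.
have xr0 : 0 < x `^ r by exact: powR_gt0.
have -> : x `^ r - y `^ r = x `^ r * (1 - y `^ r / x `^ r).
  by field; rewrite gt_eqF.
apply: (@le_trans _ _ (x `^ r * (- r * ((y - x) / x)))).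
  by rewrite ler_wpM2l// ltW.
have -> : x `^ r * (- r * ((y - x) / x)) = - r * x `^ (r - 1) * (y - x).
  rewrite powRB; last by rewrite (gt_eqF x0) implybT.
  by rewrite powRr1 ?ltW//; field; rewrite gt_eqF.
apply: ler_wpM2r; first by rewrite subr_ge0.
apply: ler_wpM2l; first by rewrite oppr_ge0.
by apply: powR_nhomo => //; lra.
Qed.

(** The value 0 of l is included: it occurs when a moving point approaches
    the pole of the distance function. *)
Lemma powR_continuous_ge0 (q : R) (d : R^nat) (l : R) : 0 < q ->
  (forall k, 0 <= d k) -> d @ \oo --> l -> (fun k => d k `^ q) @ \oo --> l `^ q.
Proof.
move=> q0 d0 dl.
have : 0 <= l.
  by rewrite -(cvg_lim _ dl)//; apply: limr_ge; [apply/cvg_ex; exists l|exact: nearW].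
rewrite le_eqVlt => /predU1P[l0|l0].
  rewrite -l0 powR0 ?gt_eqF//; rewrite -l0 in dl.
  apply/cvgr0Pnorm_lt => _/posnumP[eps].
  have eq0 : 0 < eps%:num `^ q^-1 by exact: powR_gt0.
  move/cvgr0Pnorm_lt : dl => /(_ _ eq0); apply: filterS => k.
  rewrite !ger0_norm ?powR_ge0// => dk.
  have -> : eps%:num = (eps%:num `^ q^-1) `^ q :> R.
    by rewrite -powRrM mulVf ?gt_eqF// powRr1.
  exact: powR_lt_homo.
apply: (@cvg_comp _ _ _ d (fun t => t `^ q)); first exact: dl.
have : {for l, continuous (fun t : R => t `^ q)}.
  apply: differentiable_continuous; apply/derivable1_diffP.
  by apply: derivable_powR; rewrite in_itv/= l0.
by [].
Qed.

End powers.

(** * The moving plane method *)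

Section solution.
Context {R : realType}.
Variable m : nat.
Notation n := m.+1.
Notation mu := (@lebesgue_Rn R n).
Notation B := (@unit_ball R n).
Variables (q r : R) (u : Rn R n -> R).
Hypothesis q0 : 0 < q.
Hypothesis r0 : r < 0.
Hypothesis u_measurable : measurable_fun setT u.
Hypothesis u0 : forall x, B x -> 0 < u x.
Hypothesis sol : forall x, B x -> (u x)%:E = potential q (cutoff B u r) x.

Notation f := (cutoff B u r).
Notation k x y := (@eucl_dist R n x y `^ q).

Lemma measurable_source : measurable_fun setT f.
Proof.
apply: measurable_cutoff; first exact: measurable_unit_ball.
exact: measurable_funTS.
Qed.

Lemma measurable_integrand x : measurable_fun setT (fun y => (k x y * f y)%:E).
Proof.
exact: (measurable_fun_pair2 x
  (measurable_potential_integrand q measurable_source)).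
Qed.

Lemma integrable_integrand x : B x ->
  mu.-integrable setT (fun y => (k x y * f y)%:E).
Proof.
move=> Bx; apply/integrableP; split; first exact: measurable_integrand.
rewrite (_ : (\int[mu]_y _)%E = (u x)%:E) ?ltry// sol//.
by apply: eq_integral => y _; rewrite gee0_abs// lee_fin mulr_ge0 ?powR_ge0 ?cutoff_ge0.
Qed.

(** The potential is finite at two points, and no y is close to both of them,
    so the source itself is dominated by the two integrands. *)
Lemma integrable_source : mu.-integrable setT (fun y => (f y)%:E).
Proof.
pose x1 : Rn R n := axis m 2^-1; pose x2 : Rn R n := axis m (- 2^-1).
have B1 : B x1 by apply: axis_unit_ball; rewrite ger0_norm; lra.
have B2 : B x2 by apply: axis_unit_ball; rewrite normrN ger0_norm; lra.
pose c : R := (2^-1 `^ q)^-1.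
have c0 : 0 < (2^-1 : R) `^ q by apply: powR_gt0; lra.
apply: (@le_integrable _ _ _ _ _ measurableT _
  (fun y => c%:E * ((k x1 y * f y)%:E + (k x2 y * f y)%:E))%E).
- by apply/measurable_EFinP; exact: measurable_source.
- move=> y _; rewrite -EFinD -EFinM !abse_EFin lee_fin.
  rewrite ger0_norm ?cutoff_ge0// ger0_norm; last first.
    apply: mulr_ge0; first by rewrite invr_ge0 ltW.
    by apply: addr_ge0; rewrite mulr_ge0 ?powR_ge0 ?cutoff_ge0.
  rewrite -mulrDl mulrA -[leLHS]mul1r ler_wpM2r ?cutoff_ge0//.
  rewrite mulrC ler_pdivlMr// mul1r.
  have := coord_dist_le x1 y ord0; have := coord_dist_le x2 y ord0.
  rewrite !tnth_axis0 => h2 h1.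
  have [y0|y0] := leP (tnth y ord0) 0.
    rewrite -[leLHS]addr0 lerD ?powR_ge0//; apply: powR_le_homo; [exact: ltW|lra|].
    by apply: le_trans h1; rewrite ger0_norm; lra.
  rewrite -[leLHS]add0r lerD ?powR_ge0//; apply: powR_le_homo; [exact: ltW|lra|].
  by apply: le_trans h2; rewrite ler0_norm; lra.
- apply: integrableZl => //.
  by apply: (@integrableD _ _ _ _ _ measurableT); exact: integrable_integrand.
Qed.

(** Distances in the ball are at most 2, so u is at most 2^q times the mass
    of the source. *)
Lemma solution_bounded : exists2 C, 0 < C & forall x, B x -> u x <= C.
Proof.
pose C := 2 `^ q * \int[mu]_y f y.
have C0 : 0 <= C.
  by rewrite mulr_ge0 ?powR_ge0// Rintegral_ge0// => y _; exact: cutoff_ge0.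
exists (C + 1); first lra.
move=> x Bx; suff : u x <= C by lra.
rewrite -lee_fin sol// /C EFinM fineK; last first.
  exact: integrable_fin_num integrable_source.
rewrite -ge0_integralZl//.
- apply: ge0_le_integral => //.
  + by move=> y _; rewrite lee_fin mulr_ge0 ?powR_ge0 ?cutoff_ge0.
  + exact: measurable_integrand.
  + apply: measurable_funeM; apply/measurable_EFinP; exact: measurable_source.
  + move=> y _; rewrite -EFinM lee_fin.
    have [By|By] := pselect (B y); last by rewrite cutoff_out// !mulr0.
    rewrite ler_wpM2r ?cutoff_ge0//.
    apply: powR_le_homo; [exact: ltW|exact: eucl_dist_ge0|].
    exact: eucl_dist_ball_le2.
- by apply/measurable_EFinP; exact: measurable_source.
- by move=> y _; rewrite lee_fin cutoff_ge0.
Qed.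

(** As r < 0, the upper bound on u bounds the source from below on the ball,
    and every point x is at a fixed distance from one of two small boxes, on
    either side of the hyperplane where the first coordinate vanishes. *)
Lemma solution_bounded_below : exists2 c, 0 < c & forall x, B x -> c <= u x.
Proof.
have [C C0 uC] := solution_bounded.
(* With sides of order 1 / (n + 1) the boxes fit into the ball. *)
pose h : R := n.+1%:R^-1.
have h0 : 0 < h by rewrite invr_gt0.
pose a (s : bool) (i : 'I_n) := if i == ord0 then (if s then h / 2 else - h) else - h.
pose b (s : bool) (i : 'I_n) := if i == ord0 then (if s then h else - (h / 2)) else h.
have ab s i : a s i < b s i.
  by rewrite /a /b; case: eqP => _; [case: s|]; lra.
have Qh s y i : box (a s) (b s) y -> `|tnth y i| <= h.
  move=> /(_ i) /andP[]; rewrite /a /b ler_norml.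
  by case: eqP => _; [case: s|] => h1 h2; apply/andP; split; lra.
have QB s : box (a s) (b s) `<=` B.
  move=> y Qy; apply/unit_ballE.
  apply: (@le_lt_trans _ _ (\sum_(i < n) h ^+ 2)).
    apply: ler_sum => i _; rewrite -expr2 -real_normK ?num_real//.
    by apply: lerXn2r; rewrite ?nnegrE ?(ltW h0)//; exact: Qh Qy.
  rewrite sumr_const card_ord -mulr_natl /h exprVn.
  rewrite ltr_pdivrMr ?exprn_gt0// mul1r expr2 -natrM ltr_nat.
  by rewrite (leq_trans (ltnSn _))// leq_pmulr.
pose v s : \bar R := mu (box (a s) (b s)).
have vE s : v s = (\prod_(i < n) (b s i - a s i))%:E.
  by apply: lebesgue_Rn_box => i; exact/ltW.
pose w : R := \prod_(i < n) (if i == ord0 then h / 2 else 2 * h).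
have vw s : v s = w%:E.
  rewrite vE; congr EFin; apply: eq_bigr => i _; rewrite /a /b.
  by case: eqP => _; [case: s|]; lra.
have w0 : 0 < w by apply: prodr_gt0 => i _; case: ifP => _; lra.
exists ((h / 2) `^ q * C `^ r * w).
  by rewrite !mulr_gt0// powR_gt0//; lra.
move=> x Bx; pose s := tnth x ord0 <= 0.
rewrite -lee_fin sol// EFinM -(vw s) /v.
have mQ : measurable (box (a s) (b s)) by exact: measurable_box.
rewrite -integral_cst// /potential.
apply: (@le_trans _ _ (\int[mu]_(y in box (a s) (b s)) (k x y * f y)%:E)%E).
  apply: ge0_le_integral => //.
  - by move=> y _; rewrite lee_fin mulr_ge0// powR_ge0.
  - by apply: measurable_funTS; exact: measurable_integrand.
  - move=> y Qy; rewrite lee_fin; have By := QB _ _ Qy.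
    rewrite cutoff_in//; apply: ler_pM; rewrite ?powR_ge0//.
      apply: powR_le_homo; [exact: ltW|lra|].
      apply: le_trans (coord_dist_le x y ord0).
      move: (Qy ord0); rewrite /a /b eqxx /s.
      have [x0 /andP[y0 _]|x0 /andP[_ y0]] := leP (tnth x ord0) 0.
        by rewrite ler0_norm; lra.
      by rewrite ger0_norm; lra.
    by apply: powR_nhomo; [exact: ltW|exact: u0|exact: uC].
apply: ge0_subset_integral => //.
- exact: measurable_integrand.
- by move=> y _; rewrite lee_fin mulr_ge0 ?powR_ge0 ?cutoff_ge0.
Qed.

(** Dominated convergence, the dominating function being 2^q times the
    source. Convergence of the points is expressed through distances, the only
    form in which they enter the kernel. *)
Lemma solution_continuous_along (xs : (Rn R n)^nat) x : (forall i, B (xs i)) -> B x ->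
  (forall y, eucl_dist (xs i) y @[i --> \oo] --> eucl_dist x y) ->
  u (xs i) @[i --> \oo] --> u x.
Proof.
move=> Bxs Bx dxs.
apply: (@fine_cvg _ _ _ _ (fun i => (u (xs i))%:E) (u x)).
rewrite sol//; under eq_fun do rewrite sol//.
apply: (@cvg_trans _ (\int[mu]_y (k (xs i) y * f y)%:E @[i --> \oo])%E).
  exact: cvg_refl.
have [] := @dominated_convergence _ _ _ mu setT measurableT
  (fun i y => (k (xs i) y * f y)%:E) (fun y => (k x y * f y)%:E)
  (fun y => (2 `^ q)%:E * (f y)%:E)%E => //.
- by move=> i; exact: measurable_integrand.
- exact: measurable_integrand.
- apply: aeW => y _; apply/fine_cvgP; split; first exact: nearW.
  apply: cvgM; last exact: cvg_cst.
  by apply: powR_continuous_ge0 => // i; exact: eucl_dist_ge0.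
- by apply: integrableZl => //; exact: integrable_source.
- apply: aeW => y i _; rewrite -EFinM abse_EFin lee_fin ger0_norm.
    have [By|By] := pselect (B y); last by rewrite cutoff_out// !mulr0.
    rewrite ler_wpM2r ?cutoff_ge0//.
    apply: powR_le_homo; [exact: ltW|exact: eucl_dist_ge0|].
    exact: eucl_dist_ball_le2.
  by rewrite mulr_ge0 ?powR_ge0 ?cutoff_ge0.
Qed.

Section direction.
Variable e : Rn R n.
Hypothesis e1 : dot e e = 1.
Hypothesis e0 : tnth e ord0 != 0.
Notation rho := (mirror e).

(** The points of the cap where the inequality u (rho l y) <= u y, which the
    moving plane method propagates, fails. *)
Definition misordered l : set (Rn R n) :=
  [set y | [/\ B y, l < dot e y & u y < u (rho l y)]].

Lemma measurable_misordered l : measurable (misordered l).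
Proof.
rewrite (_ : misordered l =
    B `&` ([set y | l < dot e y] `&` [set y | u y < u (rho l y)])).
  apply: measurableI; first exact: measurable_unit_ball.
  apply: measurableI.
    rewrite -[X in measurable X]setTI -preimage_itvoy.
    by apply: measurable_dot => //; exact: measurable_itv.
  rewrite -[X in measurable X]setTI.
  pose g y := u (rho l y) - u y.
  have -> : [set: Rn R n] `&` [set y | u y < u (rho l y)] =
            [set: Rn R n] `&` [set y | 0 < g y].
    by apply/seteqP; split => y [_] /= h; split => //; rewrite /g /= subr_gt0 in h *.
  have mg : measurable_fun setT g.
    apply: measurable_funB => //.
    by apply: measurableT_comp u_measurable _; exact: measurable_mirror.
  by rewrite -preimage_itvoy; apply: mg => //; exact: measurable_itv.
by apply/seteqP; split => y; [case|move=> [? []]].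
Qed.

Lemma misordered_lty l : (mu (misordered l) < +oo)%E.
Proof.
apply: le_lt_trans (lebesgue_Rn_unit_ball_lty n).
apply: le_measure; rewrite ?inE//.
- exact: measurable_misordered.
- exact: measurable_unit_ball.
by move=> y [].
Qed.

(** Twice the difference u x - u (rho l x) is the integral of this function.
    Folding the integral along the hyperplane in this symmetric way avoids
    splitting the space into the cap, its image and the rest. *)
Definition symmetrized l x y := (k x y - k x (rho l y)) * (f y - f (rho l y)).

Lemma symmetrized_mirror l x y : symmetrized l x (rho l y) = symmetrized l x y.
Proof. by rewrite /symmetrized mirrorK//; ring. Qed.

Let F x y := (k x y * f y)%:E.

(** Reflections preserve distances, so the four products are the integrands
    of the potentials at x and at rho l x, and the reflections of these. *)
Let symmetrizedE l x y : (symmetrized l x y)%:E =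
  ((F x y - F (rho l x) y) + (F x (rho l y) - F (rho l x) (rho l y)))%E.
Proof.
rewrite -!EFinB -EFinD; congr EFin.
by rewrite /symmetrized (dist_mirror e1) -(dist_mirrorC e1); ring.
Qed.

Lemma integrable_symmetrized l x : B x -> B (rho l x) ->
  mu.-integrable setT (fun y => (symmetrized l x y)%:E).
Proof.
move=> Bx Brx; have iF : mu.-integrable setT (fun y => F x y - F (rho l x) y)%E.
  by apply: integrableB => //; exact: integrable_integrand.
have iFr := integrable_preserves (preserves_mirror l e1 e0) iF.
have := integrableD measurableT iF iFr.
by congr (integrable _ _ _); apply/funext => y; rewrite symmetrizedE.
Qed.

Lemma integral_symmetrized l x : B x -> B (rho l x) ->
  (\int[mu]_y (symmetrized l x y)%:E)%E = (2 * (u x - u (rho l x)))%:E.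
Proof.
move=> Bx Brx; have iF : mu.-integrable setT (fun y => F x y - F (rho l x) y)%E.
  by apply: integrableB => //; exact: integrable_integrand.
have pr := preserves_mirror l e1 e0.
have iFr := integrable_preserves pr iF.
under eq_integral do rewrite symmetrizedE.
rewrite (integralD measurableT iF iFr) (integral_preserves pr iF).
rewrite integralB//; [|exact: integrable_integrand|exact: integrable_integrand].
rewrite [X in (X - _)%E](_ : _ = (u x)%:E); last by rewrite sol.
rewrite [X in (_ - X)%E](_ : _ = (u (rho l x))%:E); last by rewrite sol.
by rewrite -!EFinB -EFinD; congr EFin; ring.
Qed.

(** Both factors are nonpositive. For the source this uses r < 0 when y is in
    the ball, and when y is outside of the ball the source vanishes at y. *)
Lemma symmetrized_ge0 l x y : 0 <= l -> l <= dot e x -> l <= dot e y ->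
  ~ misordered l y -> 0 <= symmetrized l x y.
Proof.
move=> l0 lx; rewrite le_eqVlt => /predU1P[ly|ly] nmis.
  rewrite /symmetrized (_ : rho l y = y) ?subrr ?mul0r//.
  by apply: eq_from_tnth => i; rewrite tnth_mktuple -ly; ring.
rewrite /symmetrized -mulrNN !opprB mulr_ge0// subr_ge0.
  apply: powR_le_homo; [exact: ltW|exact: eucl_dist_ge0|].
  by apply: dist_mirror_le => //; exact: ltW.
have [By|By] := pselect (B y); last by rewrite (cutoff_out _ _ By) cutoff_ge0.
have Bry : B (rho l y) by apply: unit_ball_mirror => //; exact: ltW.
rewrite !cutoff_in//; apply: powR_nhomo; [exact: ltW|exact: u0|].
by rewrite leNgt; apply/negP => uy; apply: nmis.
Qed.

Lemma symmetrized_lower_bound c M l x y : 0 < c -> (forall z, B z -> c <= u z) ->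
  0 <= l -> B x -> l <= dot e x ->
  misordered l y -> u (rho l y) - u y <= M ->
  - symmetrized l x y <= 2 `^ q * (- r * c `^ (r - 1)) * M.
Proof.
move=> c0 cu l0 Bx lx [By ly uy] uM.
have Bry : B (rho l y) by apply: unit_ball_mirror => //; exact: ltW.
rewrite /symmetrized -mulNr opprB -mulrA; apply: ler_pM.
- rewrite subr_ge0; apply: powR_le_homo; [exact: ltW|exact: eucl_dist_ge0|].
  by apply: dist_mirror_le => //; exact: ltW.
- rewrite subr_ge0 !cutoff_in//; apply: powR_nhomo; [exact: ltW|exact: u0|exact: ltW].
- rewrite lerBlDr -[leLHS]addr0 lerD ?powR_ge0//.
  apply: powR_le_homo; [exact: ltW|exact: eucl_dist_ge0|].
  exact: eucl_dist_ball_le2.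
- rewrite !cutoff_in//; apply: le_trans (powR_lipschitz _ c0 _ _) _.
  + exact: ltW.
  + exact: cu.
  + exact: ltW.
  + by rewrite ler_wpM2l// mulr_ge0 ?powR_ge0// oppr_ge0 ltW.
Qed.

(** On the misordered set and on its reflection, symmetrized l x is bounded
    below by symmetrized_lower_bound; elsewhere it is nonnegative. Compare
    integrals. *)
Lemma gap_contraction c M l x : 0 < c -> (forall z, B z -> c <= u z) ->
  0 <= l -> 0 <= M -> (forall y, misordered l y -> u (rho l y) - u y <= M) ->
  B x -> l <= dot e x ->
  u (rho l x) - u x <= 2 `^ q * (- r * c `^ (r - 1)) * fine (mu (misordered l)) * M.
Proof.
move=> c0 cu l0 M0 gapM Bx lx.
have Brx : B (rho l x) by exact: unit_ball_mirror.
pose K := 2 `^ q * (- r * c `^ (r - 1)) * M.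
have K0 : 0 <= K.
  by rewrite /K !mulr_ge0 ?powR_ge0// oppr_ge0 ltW.
pose g y := (\1_(misordered l) y)%:E : \bar R.
have muE : mu (misordered l) = (fine (mu (misordered l)))%:E.
  by rewrite fineK// ge0_fin_numE//; exact: misordered_lty.
have mb := measurable_misordered l.
have ig : mu.-integrable setT g.
  apply/integrableP; split; first by apply/measurable_EFinP; exact: measurable_indic.
  rewrite (eq_integral g) => [|y _]; last by rewrite gee0_abs// lee_fin.
  by rewrite integral_indic// setIT; exact: misordered_lty.
have pr := preserves_mirror l e1 e0.
have igr := integrable_preserves pr ig.
have igg := integrableD measurableT ig igr.
have ia := integrable_symmetrized Bx Brx.
have Kig := integrableZl measurableT K igg.
have : (0 <= \int[mu]_y ((symmetrized l x y)%:E + K%:E * (g y + g (rho l y))))%E.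
  apply: integral_ge0 => y _.
  suff : 0 <= symmetrized l x y +
      K * (\1_(misordered l) y + \1_(misordered l) (rho l y)).
    by rewrite -lee_fin.
  (* Everything is invariant under y |-> rho l y. *)
  wlog ly : y / l <= dot e y.
    move=> H; have [|ly] := leP l (dot e y); first exact: H.
    rewrite -(symmetrized_mirror l x y) addrC (addrC (\1_ _ y)).
    rewrite -{2}(mirrorK e1 l y) addrC; apply: H.
    by rewrite (dot_mirror e1); lra.
  have [yb|yb] := pselect (misordered l y).
    have hK := symmetrized_lower_bound c0 cu l0 Bx lx yb (gapM _ yb).
    rewrite -/K in hK.
    rewrite [X in K * (X + _)]indicE mem_set//= mulrDr mulr1.
    have : 0 <= K * \1_(misordered l) (rho l y) by rewrite mulr_ge0.
    lra.
  by rewrite addr_ge0 ?symmetrized_ge0// mulr_ge0// addr_ge0.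
rewrite (integralD measurableT ia Kig) (integralZl measurableT igg).
rewrite (integralD measurableT ig igr) (integral_preserves pr ig).
have -> : (\int[mu]_y g y = (fine (mu (misordered l)))%:E)%E.
  by rewrite /g integral_indic// setIT.
rewrite integral_symmetrized// lee_fin.
rewrite /K; set w := fine _; lra.
Qed.

(** By gap_contraction the supremum of the gap u (rho l y) - u y over the
    misordered set is at most theta times itself, where theta < 1 is the left-hand
    side of the last hypothesis. This plays the role of a maximum principle in
    narrow domains. *)
Lemma misordered_small c l : 0 < c -> (forall z, B z -> c <= u z) -> 0 <= l ->
  2 `^ q * (- r * c `^ (r - 1)) * fine (mu (misordered l)) < 1 -> misordered l = set0.
Proof.
move=> c0 cu l0 theta1; set theta := (X in X < 1) in theta1.
have [C C0 uC] := solution_bounded.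
rewrite -subset0 => x bx.
pose S := [set u (rho l y) - u y | y in misordered l].
have Sx : S (u (rho l x) - u x) by exists x.
have hS : has_sup S.
  split; first by exists (u (rho l x) - u x).
  exists C => _ [y [By ly _] <-].
  have Bry : B (rho l y) by apply: unit_ball_mirror => //; exact: ltW.
  by have := uC _ Bry; have := u0 By; lra.
have gapS y : misordered l y -> u (rho l y) - u y <= sup S.
  by move=> yb; apply: ub_le_sup; [case: hS|exists y].
have S0 : 0 < sup S.
  by apply: lt_le_trans (gapS _ bx); case: bx => _ _; rewrite subr_gt0.
have : sup S <= theta * sup S.
  apply: ge_sup; first by case: hS.
  move=> _ [y [By ly uy] <-].
  by apply: gap_contraction => //; exact: ltW.
by rewrite leNgt gtr_pMl// theta1.
Qed.

(** A hyperplane at positive distance l from the origin makes the two sides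
    unequal: the points near - e are reflected out of the ball. The centre
    - (1 - l / 4) e and half side l / (8 n) leave room for elementary
    estimates. *)
Lemma box_off_mirror l : 0 < l -> l < 1 -> exists a b : 'I_n -> R,
  (forall i, a i < b i) /\ box a b `<=`
    [set z | [/\ B z, dot e z < l & ~ B (rho l z)]].
Proof.
move=> l0 l1; pose eps := l / 4; pose del := eps / 2; pose eta := del / n%:R.
have eps0 : 0 < eps by rewrite /eps; lra.
have del0 : 0 < del by rewrite /del; lra.
have eta0 : 0 < eta by rewrite divr_gt0.
exists (fun i => - (1 - eps) * tnth e i - eta).
exists (fun i => - (1 - eps) * tnth e i + eta).
split => [i|z zab]; first by lra.
pose t := 1 - eps.
pose w := dot z z + 2 * t * dot e z + t ^+ 2.
have H a : \sum_(i < n) (tnth z i - a * tnth e i) ^+ 2 =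
    dot z z - 2 * a * dot e z + a ^+ 2 * dot e e.
  rewrite /dot !mulr_sumr -sumrB -big_split/=.
  by apply: eq_bigr => i _; ring.
have wE : w = \sum_(i < n) (tnth z i - (- t) * tnth e i) ^+ 2.
  by rewrite H e1 /w; ring.
have w0 : 0 <= w by rewrite wE; apply: sumr_ge0 => i _; exact: sqr_ge0.
have wdel : w <= del ^+ 2.
  rewrite wE; apply: (@le_trans _ _ (\sum_(i < n) eta ^+ 2)).
    apply: ler_sum => i _; have := zab i => /andP[z1 z2].
    rewrite -real_normK ?num_real//; apply: lerXn2r; rewrite ?nnegrE ?(ltW eta0)//.
    by rewrite ler_norml /t; apply/andP; split; lra.
  rewrite sumr_const card_ord -mulr_natl.
  have -> : n%:R * eta ^+ 2 = del ^+ 2 * n%:R^-1.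
    by rewrite /eta; field.
  by rewrite ler_piMr ?sqr_ge0// invf_le1 ?ler1n.
(* Cauchy-Schwarz for e and z + t e, whose squared norm is w. *)
have adel : (dot e z + t) ^+ 2 <= del ^+ 2.
  apply: le_trans wdel; rewrite -subr_ge0.
  have -> : w - (dot e z + t) ^+ 2 =
      \sum_(i < n) (tnth z i - dot e z * tnth e i) ^+ 2.
    rewrite H e1 /w; ring.
  by apply: sumr_ge0 => i _; exact: sqr_ge0.
have /andP[a1 a2] : - del <= dot e z + t <= del.
  rewrite -ler_norml -(@ler_pXn2r _ 2)// ?nnegrE ?(ltW del0)//.
  by rewrite real_normK ?num_real.
have sE : dot z z = w - 2 * t * dot e z - t ^+ 2 by rewrite /w; ring.
have eps1 : eps < 1 / 4 by rewrite /eps; lra.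
have t_gt : 3 / 4 <= t by rewrite /t /eps; lra.
have t_lt : t = 1 - eps by [].
have az : dot e z < 0 by rewrite /del in a2; lra.
split.
- apply/unit_ballE; rewrite sE.
  have : - t * dot e z <= t * (t + del) by nra.
  have : (t + del) ^+ 2 < 1.
    by rewrite expr_lt1//; rewrite /del; lra.
  nra.
- exact: lt_trans l0.
- move/unit_ballE; rewrite (sqr_norm_mirror e1) sE.
  apply/negP; rewrite -leNgt.
  have : t * (t - del) <= - t * dot e z by nra.
  have -> : l = 4 * eps by rewrite /eps; lra.
  have -> : del = eps / 2 by [].
  nra.
Qed.

(** When nothing is misordered, symmetrized l x is nonnegative, and it is
    positive on the box of box_off_mirror, whose points are in the ball while
    their mirror images are not; so its integral is not 0. *)
Lemma mirror_strict l x : 0 < l -> l < 1 -> misordered l = set0 -> B x -> l < dot e x ->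
  u (rho l x) < u x.
Proof.
move=> l0 l1 nmis Bx lx.
have Brx : B (rho l x) by apply: unit_ball_mirror => //; exact: ltW.
have age0 y : 0 <= symmetrized l x y.
  have nb z : ~ misordered l z by rewrite nmis.
  have [ly|ly] := leP l (dot e y); first by apply: symmetrized_ge0 => //; exact: ltW.
  rewrite -symmetrized_mirror; apply: symmetrized_ge0 => //; try exact: ltW.
  by rewrite (dot_mirror e1); lra.
have ia := integrable_symmetrized Bx Brx.
have iE := integral_symmetrized Bx Brx.
have : (0 <= \int[mu]_y (symmetrized l x y)%:E)%E.
  by apply: integral_ge0 => y _; rewrite lee_fin.
rewrite iE lee_fin le_eqVlt => /predU1P[h|]; last by lra.
exfalso.
have : (\int[mu]_y `|(symmetrized l x y)%:E| = 0)%E.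
  under eq_integral do rewrite gee0_abs ?lee_fin//.
  by rewrite iE -h.
move/(ae_eq_integral_abs mu measurableT (measurable_int _ ia)) => [N [mN N0 sN]].
have [a [b [ab abZ]]] := box_off_mirror l0 l1.
have : (mu (box a b) <= mu N)%E.
  apply: le_measure; rewrite ?inE//; first exact: measurable_box.
  move=> z /abZ [Bz lz Brz]; apply: sN => /= /(_ I) [].
  apply/eqP; rewrite gt_eqF// /symmetrized (cutoff_out _ _ Brz) subr0 mulr_gt0//.
    rewrite subr_gt0; apply: powR_lt_homo => //; first exact: eucl_dist_ge0.
    rewrite -{2}(mirrorK e1 l z); apply: dist_mirror_lt => //.
    by rewrite (dot_mirror e1); lra.
  by rewrite cutoff_in//; exact/powR_gt0/u0.
by rewrite N0 leNgt lebesgue_Rn_box_gt0.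
Qed.

Lemma solution_mirror_cvg (ls : R^nat) l x : B x -> ls @ \oo --> l ->
  (forall i, B (rho (ls i) x)) -> B (rho l x) ->
  u (rho (ls i) x) @[i --> \oo] --> u (rho l x).
Proof.
move=> Bx lsl Bs Bl; apply: solution_continuous_along => // y.
have distE l' : eucl_dist (rho l' x) y =
    Num.sqrt (eucl_dist x y ^+ 2 + 4 * (dot e x - l') * (dot e y - l')).
  by rewrite -(sqr_dist_mirrorl e1) sqrtr_sqr ger0_norm// eucl_dist_ge0.
rewrite distE; under eq_fun do rewrite distE.
apply: (@cvg_comp _ _ _ _ (@Num.sqrt R)); last exact: sqrt_continuous.
apply: cvgD; first exact: cvg_cst.
apply: cvgM; first apply: cvgM; first exact: cvg_cst.
  by apply: cvgB => //; exact: cvg_cst.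
by apply: cvgB => //; exact: cvg_cst.
Qed.

Lemma misordered_closed l : 0 <= l -> l < 1 ->
  (forall l', l < l' -> l' < 1 -> misordered l' = set0) -> misordered l = set0.
Proof.
move=> l0 l1 gt_l; rewrite -subset0 => x [Bx lx ux].
have d0 : 0 < (dot e x - l) / 2 by lra.
pose ls k := l + (dot e x - l) / 2 * harmonic k.
have ls_gt k : l < ls k by rewrite ltrDl mulr_gt0//; exact: harmonic_gt0.
have ls_lt k : ls k < dot e x.
  apply: (@le_lt_trans _ _ (l + (dot e x - l) / 2)); last by lra.
  rewrite lerD2l ler_piMr ?(ltW d0)// /harmonic/= invf_le1 ?ler1n//.
have lsl : ls @ \oo --> l.
  rewrite -[X in _ --> X]addr0 -[X in _ --> _ + X](mulr0 ((dot e x - l) / 2)).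
  apply: cvgD; first exact: cvg_cst.
  by apply: cvgM; [exact: cvg_cst|exact: cvg_harmonic].
have Bs k : B (rho (ls k) x).
  apply: unit_ball_mirror => //; last exact: ltW.
  exact: le_trans (ltW (ls_gt k)).
have Bl : B (rho l x) by apply: unit_ball_mirror => //; exact: ltW.
have cu := solution_mirror_cvg Bx lsl Bs Bl.
suff : u (rho l x) <= u x by rewrite leNgt ux.
rewrite -(cvg_lim _ cu)//; apply: limr_le.
  by apply/cvg_ex; exists (u (rho l x)).
apply: nearW => k; rewrite leNgt; apply/negP => uk.
have : misordered (ls k) x by [].
by rewrite gt_l//; exact: lt_trans (ls_lt k) (dot_lt1 e1 Bx).
Qed.

(** A point off the limiting hyperplane eventually leaves the misordered
    sets: below the hyperplane it leaves the cap, and above it the strict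
    inequality at l persists for nearby hyperplanes. The case l = 1, where the
    limiting cap is empty, starts the moving plane method. *)
Lemma misordered_measure_cvg0 (ls : R^nat) l :
  0 < l -> (l < 1 -> misordered l = set0) ->
  (forall i, 0 <= ls i /\ ls i < l) -> ls @ \oo --> l ->
  fine (mu (misordered (ls i))) @[i --> \oo] --> (0 : R).
Proof.
move=> l0 ordl lslt lsl.
have mB := @measurable_unit_ball R n.
apply: (@fine_cvg _ _ _ _ (fun i => mu (misordered (ls i))) 0).
have -> : (fun i => mu (misordered (ls i))) =
    (fun i => \int[mu]_y (\1_(misordered (ls i)) y)%:E)%E.
  apply/funext => i; rewrite integral_indic ?setIT//.
  exact: measurable_misordered.
have [] := @dominated_convergence _ _ _ mu setT measurableT
  (fun i y => (\1_(misordered (ls i)) y)%:E) (fun=> 0%E) (fun y => (\1_B y)%:E).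
- move=> i; apply/measurable_EFinP; apply: measurable_indic.
  exact: measurable_misordered.
- exact: measurable_cst.
- exists [set y | dot e y = l]; split.
  + exact: measurable_hyperplane.
  + exact: lebesgue_Rn_hyperplane.
  + move=> y /= ncv; apply: contrapT => ynl; apply: ncv => _.
    apply: cvg_near_cst.
    have [By|By] := pselect (B y); last first.
      by apply: nearW => i; rewrite indicE memNset// => -[].
    have [yl|ly|/esym//] := ltgtP (dot e y) l.
      apply: (filterS _ (cvgr_gt l lsl _ yl)) => i /= yi.
      by rewrite indicE memNset// => -[_ /(lt_trans yi)]; rewrite ltxx.
    have l1 : l < 1 by exact: lt_trans ly (dot_lt1 e1 By).
    have Bl : B (rho l y) by apply: unit_ball_mirror => //; exact: ltW.
    have Bs i : B (rho (ls i) y).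
      have [ls0 lsl'] := lslt i.
      by apply: unit_ball_mirror => //; apply: ltW; exact: lt_trans ly.
    have cu := solution_mirror_cvg By lsl Bs Bl.
    have uy := mirror_strict l0 l1 (ordl l1) By ly.
    apply: (filterS _ (cvgr_lt _ cu _ uy)) => i /= ui.
    by rewrite indicE memNset// => -[_ _ /(lt_trans ui)]; rewrite ltxx.
- apply/integrableP; split; first by apply/measurable_EFinP; exact: measurable_indic.
  rewrite (eq_integral (fun y => (\1_B y)%:E)) => [|y _]; last first.
    by rewrite gee0_abs// lee_fin.
  by rewrite integral_indic// setIT; exact: lebesgue_Rn_unit_ball_lty.
- apply: aeW => y i _; rewrite gee0_abs ?lee_fin//.
  rewrite !indicE ler_nat; case: (boolP (y \in misordered _)) => //.
  by move=> /set_mem[By _ _]; rewrite mem_set.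
by rewrite integral0.
Qed.

Lemma misordered_step l : 0 < l -> (l < 1 -> misordered l = set0) ->
  exists2 eps, 0 < eps &
    forall l', 0 <= l' -> l - eps < l' -> l' < l -> misordered l' = set0.
Proof.
move=> l0 ordl; apply: contrapT => H.
have /choice[ls lsP] : forall k, exists l',
    [/\ 0 <= l', l - harmonic k < l', l' < l & misordered l' <> set0].
  move=> k; apply: contrapT => Hk; apply: H.
  exists (harmonic k); first exact: harmonic_gt0.
  move=> l' l'0 l'1 l'2; apply: contrapT => bl'; apply: Hk.
  by exists l'.
have lsl : ls @ \oo --> l.
  apply: (@squeeze_cvgr _ _ _ _ (fun k => l - harmonic k) (fun=> l)).
  - apply: nearW => k; have [_ h1 h2 _] := lsP k.
    by apply/andP; split; exact: ltW.
  - rewrite -[X in _ --> X]subr0; apply: cvgB; first exact: cvg_cst.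
    exact: cvg_harmonic.
  - exact: cvg_cst.
have [c c0 cu] := solution_bounded_below.
have mu0 : fine (mu (misordered (ls i))) @[i --> \oo] --> (0 : R).
  by apply: (misordered_measure_cvg0 l0 ordl _ lsl) => i; have [] := lsP i.
pose K : R := 2 `^ q * (- r * c `^ (r - 1)).
have cv0 : K * fine (mu (misordered (ls i))) @[i --> \oo] --> (0 : R).
  by rewrite -[X in _ --> X](mulr0 K); apply: cvgM => //; exact: cvg_cst.
have := cvgr_lt _ cv0 _ ltr01.
case=> N _ /(_ N (leqnn N)) /= theta1.
have [ls0 _ _] := lsP N; apply.
exact: misordered_small c0 cu ls0 theta1.
Qed.

(** The moving plane: let s be the infimum of the a such that all
    hyperplanes beyond a order the solution. By closedness so does s, and if s
    were positive the hyperplane could be moved a little further. *)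
Lemma misordered_empty l : 0 <= l -> l < 1 -> misordered l = set0.
Proof.
pose A := [set a | 0 <= a /\ forall l', a < l' -> l' < 1 -> misordered l' = set0].
have A1 : A 1 by split => // l' /ltW; rewrite leNgt => /negbTE ->.
have lbA : lbound A 0 by move=> a [].
have hA : has_inf A by split; [exists 1|exists 0].
pose s := inf A.
have s0 : 0 <= s by apply: lb_le_inf => //; exists 1.
have gt_s l' : s < l' -> l' < 1 -> misordered l' = set0.
  move=> sl' l'1; have [|a [_ Aa]] := @inf_adherent _ A (l' - s) _ hA.
    by rewrite subr_gt0.
  by rewrite addrCA subrr addr0 => al'; exact: Aa.
have ords : s < 1 -> misordered s = set0 by move=> s1; exact: misordered_closed.
suff s_eq0 : s = 0.
  rewrite le_eqVlt => /predU1P[<- _|l0 l1]; last by apply: gt_s => //; rewrite s_eq0.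
  by rewrite -s_eq0 ords// s_eq0.
apply/eqP; rewrite eq_le s0 andbT leNgt; apply/negP => s_gt0.
have [eps eps0 step] := misordered_step s_gt0 ords.
pose a := Num.max 0 (s - eps / 2).
have a_lt : a < s by rewrite /a gt_max s_gt0/=; lra.
suff : A a by move=> /(ge_inf (ex_intro _ 0 lbA)); rewrite leNgt a_lt.
have a_ge : s - eps / 2 <= a by rewrite /a le_max lexx orbT.
have a_ge0 : 0 <= a by rewrite /a le_max lexx.
split => // l' al' l'1; have [l's|sl'|l'E] := ltgtP l' s.
- by apply: step => //; [exact: le_trans (ltW al')|lra].
- exact: gt_s.
- by rewrite l'E ords// -l'E.
Qed.

Lemma solution_mirror_le l x : 0 <= l -> l < 1 -> B x -> l <= dot e x ->
  u (rho l x) <= u x.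
Proof.
move=> l0 l1 Bx; rewrite le_eqVlt => /predU1P[lx|lx].
  rewrite (_ : rho l x = x)//.
  by apply: eq_from_tnth => i; rewrite tnth_mktuple -lx; ring.
rewrite leNgt; apply/negP => ux.
have : misordered l x by [].
by rewrite misordered_empty.
Qed.

Lemma solution_mirror_lt l x : 0 < l -> l < 1 -> B x -> l < dot e x ->
  u (rho l x) < u x.
Proof.
by move=> l0 l1 Bx lx; apply: mirror_strict => //; rewrite misordered_empty// ltW.
Qed.

End direction.

(** The hyperplane has reached the origin, and can do so from both
    directions e and - e. *)
Lemma solution_mirror0 e x : dot e e = 1 -> tnth e ord0 != 0 -> B x ->
  u (mirror e 0 x) = u x.
Proof.
move=> e1 e0; wlog ex : x / 0 <= dot e x.
  move=> H Bx; have [|ex] := leP 0 (dot e x); first by move=> ?; exact: H.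
  have Brx : B (mirror e 0 x).
    apply/unit_ballE; rewrite (sqr_norm_mirror e1) mulr0 mul0r subr0.
    exact/unit_ballE.
  rewrite -[in RHS](mirrorK e1 0 x) [RHS]H//.
  by rewrite (dot_mirror e1); lra.
move=> Bx; have Brx : B (mirror e 0 x) by exact: unit_ball_mirror.
apply/eqP; rewrite eq_le (solution_mirror_le e1 e0)//=.
pose e' : Rn R n := [tuple - tnth e i | i < n].
have dot' y : dot e' y = - dot e y.
  by rewrite /dot -sumrN; apply: eq_bigr => i _; rewrite tnth_mktuple mulNr.
have mir' y : mirror e' 0 y = mirror e 0 y.
  by apply: eq_from_tnth => i; rewrite !tnth_mktuple dot'; ring.
have e'1 : dot e' e' = 1.
  by rewrite -e1; apply: eq_bigr => i _; rewrite !tnth_mktuple mulrNN.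
have e'0 : tnth e' ord0 != 0 by rewrite tnth_mktuple oppr_eq0.
have := @solution_mirror_le e' e'1 e'0 0 _ (lexx 0) ltr01 Brx.
rewrite mir' (mirrorK e1); apply.
by rewrite dot' (dot_mirror e1); lra.
Qed.

(** The reflection exchanging x and the point of the first half-axis with the
    same norm passes through the origin, with normal vector x - axis m s, whose
    first coordinate is nonzero unless x is already that point. *)
Lemma solution_radial x : B x -> u x = u (axis m (eucl_norm x)).
Proof.
move=> Bx; set s := eucl_norm x.
have ss : s ^+ 2 = dot x x by exact: sqr_eucl_norm.
have [x0|x0] := eqVneq (tnth x ord0) s.
  congr u; apply: eq_from_tnth => i; rewrite tnth_mktuple; case: eqP => [->//|/eqP i0].
  move: ss; rewrite /dot (bigD1 ord0)//= -expr2 x0 => /eqP.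
  rewrite -[X in X == _]addr0 (inj_eq (addrI _)) eq_sym => /eqP sum0.
  have sq0 (j : 'I_n) : j != ord0 -> 0 <= tnth x j * tnth x j.
    by move=> _; rewrite -expr2 sqr_ge0.
  have /eqP := psumr_eq0P sq0 sum0 i0.
  by rewrite -expr2 sqrf_eq0 => /eqP.
pose N := eucl_dist x (axis m s).
have N0 : 0 < N.
  apply: lt_le_trans (coord_dist_le x (axis m s) ord0).
  by rewrite tnth_axis0 normr_gt0 subr_eq0.
have dxa : dot x (axis m s) = s * tnth x ord0.
  by rewrite -dot_axis; apply: eq_bigr => i _; rewrite mulrC.
have NN : N ^+ 2 = 2 * (s ^+ 2 - s * tnth x ord0).
  by rewrite sqr_eucl_dist_dot dxa dot_axis tnth_axis0 -ss; ring.
pose e : Rn R n := [tuple (tnth x i - tnth (axis m s) i) / N | i < n].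
have dote y : dot e y = (dot x y - dot (axis m s) y) / N.
  rewrite /dot -sumrB mulr_suml; apply: eq_bigr => i _.
  by rewrite tnth_mktuple; ring.
have ex : dot e x = N / 2.
  rewrite dote dot_axis -ss (_ : s ^+ 2 - _ = N ^+ 2 / 2); last by rewrite NN; field.
  by field; rewrite gt_eqF.
have e1 : dot e e = 1.
  have -> : dot e e = N ^+ 2 / N ^+ 2.
    rewrite /N {1}sqr_eucl_dist mulr_suml; apply: eq_bigr => i _.
    by rewrite tnth_mktuple -/N; field; rewrite gt_eqF.
  by rewrite divff// expf_neq0// gt_eqF.
rewrite -(solution_mirror0 e1 _ Bx); last first.
  by rewrite tnth_mktuple tnth_axis0 mulf_neq0 ?invr_neq0 ?subr_eq0// gt_eqF.
congr u; apply: eq_from_tnth => i.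
rewrite /mirror tnth_mktuple subr0 ex /e tnth_mktuple.
by field; rewrite gt_eqF.
Qed.

(** The points axis m s and axis m t are exchanged by the reflection in the
    hyperplane halfway between them. *)
Lemma solution_increasing s t : 0 <= s -> s < t -> t < 1 ->
  u (axis m s) < u (axis m t).
Proof.
move=> s0 st t1.
have Bt : B (axis m t) by apply: axis_unit_ball; rewrite ger0_norm; lra.
have := @solution_mirror_lt (axis m 1) _ _ ((s + t) / 2) (axis m t).
rewrite !dot_axis !tnth_axis0 !mul1r.
rewrite (_ : mirror _ _ _ = axis m s).
  by apply => //; rewrite ?oner_neq0//; lra.
apply: eq_from_tnth => i; rewrite tnth_mktuple dot_axis tnth_axis0 !tnth_mktuple.
by case: eqP => _; [field|ring].
Qed.

End solution.

Theorem theorem3p3 (R : realType) (n : nat) (alpha p : R) (u : Rn R n -> R)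
    (n_gt0 : (0 < n)%N) (alpha_gt : n%:R < alpha)
    (p_gt : 2 * n%:R / (n%:R - alpha) < p) (p_lt0 : p < 0)
    (u_meas : lebesgue_measurable_fun (unit_ball n) u)
    (u_gt0 : forall x, unit_ball n x -> 0 < u x)
    (u_Lp : (\int[lebesgue_Rn n]_(x in unit_ball n) (u x `^ p)%:E < +oo)%E)
    (u_sol : forall x, unit_ball n x ->
      (u x)%:E = (\int[lebesgue_Rn n]_(y in unit_ball n)
        (u y `^ (p - 1) / eucl_dist x y `^ (n%:R - alpha))%:E)%E) :
  exists phi : R -> R,
    (forall x, unit_ball n x -> u x = phi (eucl_norm x)) /\
    (forall s t, 0 <= s -> s < t -> t < 1 -> phi s < phi t).
Proof.
case: n n_gt0 alpha_gt p_gt u u_meas u_gt0 u_Lp u_sol => // m _ alpha_gt _ u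
  u_meas u_gt0 _ u_sol.
pose q := alpha - m.+1%:R.
have q0 : 0 < q by rewrite subr_gt0.
have r0 : p - 1 < 0 by lra.
have sol x : unit_ball m.+1 x -> (u x)%:E = (\int[lebesgue_Rn m.+1]_(y in
    unit_ball m.+1) (eucl_dist x y `^ q * u y `^ (p - 1))%:E)%E.
  move=> Bx; rewrite u_sol//; apply: eq_integral => y _.
  by rewrite -powRN opprB mulrC.
have mBu := solution_Borel u_meas sol.
have mB := @measurable_unit_ball R m.+1.
(* The potential is a globally measurable extension of u. *)
pose f := cutoff (unit_ball m.+1) u (p - 1).
pose v x := fine (potential q f x).
have vu x : unit_ball m.+1 x -> v x = u x.
  by move=> Bx; rewrite /v -integral_cutoff -sol.
have mv : measurable_fun setT v.
  apply: (measurableT_comp (fine_measurable measurableT)).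
  apply: measurable_potential; last by move=> y; exact: cutoff_ge0.
  exact: measurable_cutoff.
have v_gt0 x : unit_ball m.+1 x -> 0 < v x by move=> Bx; rewrite vu// u_gt0.
have v_sol x : unit_ball m.+1 x ->
    (v x)%:E = potential q (cutoff (unit_ball m.+1) v (p - 1)) x.
  move=> Bx; rewrite vu// sol// integral_cutoff; congr (potential _ _ _).
  apply/funext => y; rewrite /cutoff !patchE.
  by case: ifPn => // /set_mem By; rewrite vu.
exists (fun s => v (axis m s)); split => [x Bx|s t s0 st t1].
  by rewrite -(solution_radial q0 r0 mv v_gt0 v_sol Bx) vu.
exact: (solution_increasing q0 r0 mv v_gt0 v_sol s0 st t1).
Qed.
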